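(* Let $k\ge 2$ be an integer. For every real $s>1$ and every family of positive real numbers $x_s(n), y_s(n), z_s(n)$ ($n\ge 1$) arising from the parametrization described in the context, so that $\frac{k}{n^s}=\frac{1}{x_s(n)}+\frac{1}{y_s(n)}+\frac{1}{z_s(n)}$ for every integer $n\ge 1$, the function $$G_k(s)=\sum_{n=1}^{\infty}\left(\frac{1}{x_s(n)}+\frac{1}{y_s(n)}+\frac{1}{z_s(n)}\right)$$ satisfies $$G_k(s)=k\,\zeta(s),$$ where $\zeta$ is the Riemann zeta function.
   Context: For real numbers $x>0$, $t>0$, $s>1$, an integer $k\ge 2$ and an integer $n\ge 1$, set $F_{x,t}^{(k)}(n^s)=t^2(kx-n^s)^2-2n^s x t$. Parametrization: for each integer $n\ge 1$ (and given $s$) one chooses real numbers $x=x_s(n)>0$ and $t=t_s(n)>0$ and a real number $m_s(n)\ge 0$ such that $F_{x,t}^{(k)}(n^s)=m_s(n)^2$, and one sets $y_s(n)=t(kx-n^s)-m_s(n)$ and $z_s(n)=t(kx-n^s)+m_s(n)$. The choices are made so that $x_s(n),y_s(n),z_s(n)$ are all positive real numbers. They satisfy $\frac{k}{n^s}=\frac{1}{x_s(n)}+\frac{1}{y_s(n)}+\frac{1}{z_s(n)}$ for every $n\ge1$. The parameters $x$ and $t$ may depend on $n$ and $s$. *)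

(* Defs.v *)
From Stdlib Require Import Reals.
From Coquelicot Require Import Coquelicot.
Open Scope R_scope.

(* Real power n^s. [Rpower a s] is exp (s * ln a), the usual power for a > 0;
   it is only used below with n >= 1. *)
Definition npow (n : nat) (s : R) : R := Rpower (INR n) s.

(* The Riemann zeta function on real s > 1, by its defining Dirichlet series.
   Coquelicot's [Series] is indexed from 0, hence the shift [S j].
   The value is meaningful only for s > 1, where the series converges. *)
Definition zeta (s : R) : R := Series (fun j : nat => / npow (S j) s).

(* F_{x,t}^{(k)}(N), with N standing for n^s. *)
Definition F (k : nat) (x t N : R) : R :=
  t ^ 2 * (INR k * x - N) ^ 2 - 2 * N * x * t.

(* The families x_s(n), y_s(n), z_s(n), n >= 1, for a fixed s. The parameters
   t and m may depend on n; values at n = 0 are unconstrained and never used. *)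
Definition parametrized (k : nat) (s : R) (x y z : nat -> R) : Prop :=
  forall n : nat, (1 <= n)%nat ->
    0 < x n /\ 0 < y n /\ 0 < z n /\
    exists t m : R,
      0 < t /\ 0 <= m /\
      F k (x n) t (npow n s) = m ^ 2 /\
      y n = t * (INR k * x n - npow n s) - m /\
      z n = t * (INR k * x n - npow n s) + m.

(* Term number j of the series G_k(s) is the one at n = j + 1. *)
Definition G_term (x y z : nat -> R) (j : nat) : R :=
  1 / x (S j) + 1 / y (S j) + 1 / z (S j).

Definition G (x y z : nat -> R) : R := Series (G_term x y z).

(* Main.v *)
Require Import Defs.
From Stdlib Require Import Reals Lra Lia.
From Coquelicot Require Import Coquelicot.
Open Scope R_scope.

(** Write [N] for [n^s] and [A = t (k x - N)]. The equation [F = m^2] says exactly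
    that [A^2 - m^2 = 2 N x t], so [y = A - m] and [z = A + m] have sum [2 A] and
    product [2 N x t]. Hence [1/y + 1/z = (k x - N) / (N x) = k/N - 1/x]; the
    parameters [t] and [m] disappear, and the terms of [G] are the terms [k / n^s]
    of [k] times the zeta series ([egyptian_identity]).

    What remains is the convergence of the zeta series for [s > 1]
    ([ex_series_zeta]). With [a = s - 1 > 0], the telescoping differences
    [n^(-a) - (n+1)^(-a)] dominate [a (n+1)^(-s)] ([npow_telescope]), which bounds
    the increasing partial sums by [1 + 1/a]. *)

(** * The three-term decomposition *)

Lemma npow_pos (n : nat) (s : R) : 0 < npow n s.
Proof. apply exp_pos. Qed.

(** Positivity of [N], [x], [t] makes the product [y z = 2 N x t] nonzero, so the
    sum of the reciprocals can be computed as [(y + z) / (y z)]. *)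
Lemma egyptian_identity (k : nat) (x y z t m N : R) :
  0 < N -> 0 < x -> 0 < y -> 0 < z -> 0 < t ->
  F k x t N = m ^ 2 ->
  y = t * (INR k * x - N) - m -> z = t * (INR k * x - N) + m ->
  INR k / N = 1 / x + 1 / y + 1 / z.
Proof.
  intros HN Hx Hy Hz Ht HF Ey Ez.
  assert (Hprod : y * z = 2 * N * x * t).
  { unfold F in HF. subst y z. nra. }
  assert (Hsum : y + z = 2 * t * (INR k * x - N)) by (subst y z; ring).
  assert (Hyz : 1 / y + 1 / z = (y + z) / (y * z)) by (field; lra).
  rewrite Rplus_assoc, Hyz, Hsum, Hprod.
  field; repeat split; lra.
Qed.

(** * Convergence of the zeta series *)

Lemma ln_succ_ratio_ge (u : R) : 0 < u -> / (u + 1) <= ln (u + 1) - ln u.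
Proof.
  intros Hu.
  (* Apply [exp v >= 1 + v] at [v = ln u - ln (u + 1)], where [exp v = u / (u + 1)]. *)
  assert (He : exp (ln u - ln (u + 1)) = 1 - / (u + 1)).
  { unfold Rminus at 1. rewrite exp_plus, exp_Ropp, !exp_ln by lra.
    field; lra. }
  pose proof (exp_ineq1_le (ln u - ln (u + 1))). lra.
Qed.

(** The integral comparison for [u^(-s)] on [[n, n+1]] in discrete form. Dividing
    by [(n+1)^(1-s)], it reads [(1 + 1/n)^(s-1) >= 1 + (s-1)/(n+1)], which follows
    from [exp v >= 1 + v] and [ln (1 + 1/n) >= 1/(n+1)]. *)
Lemma npow_telescope (s : R) (n : nat) : 1 < s -> (1 <= n)%nat ->
  (s - 1) * / npow (S n) s <= npow n (1 - s) - npow (S n) (1 - s).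
Proof.
  intros Hs Hn.
  assert (Hu : 0 < INR n) by (apply lt_0_INR; lia).
  pose proof (ln_succ_ratio_ge (INR n) Hu) as Hln.
  unfold npow. rewrite S_INR. set (u := INR n) in *.
  assert (Hinv : / Rpower (u + 1) s = Rpower (u + 1) (1 - s) * / (u + 1)).
  { unfold Rminus. rewrite Rpower_plus, Rpower_1, Rpower_Ropp by lra.
    field; split; [lra | apply Rgt_not_eq, exp_pos]. }
  assert (Hquot : Rpower u (1 - s) =
    Rpower (u + 1) (1 - s) * exp ((s - 1) * (ln (u + 1) - ln u))).
  { unfold Rpower. rewrite <- exp_plus. f_equal; ring. }
  rewrite Hinv, Hquot.
  pose proof (exp_ineq1_le ((s - 1) * (ln (u + 1) - ln u))) as Hexp.
  assert (Hlow : (s - 1) * / (u + 1) <= exp ((s - 1) * (ln (u + 1) - ln u)) - 1).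
  { apply Rle_trans with ((s - 1) * (ln (u + 1) - ln u)); [|lra].
    apply Rmult_le_compat_l; lra. }
  assert (HP : 0 < Rpower (u + 1) (1 - s)) by apply exp_pos.
  nra.
Qed.

Lemma zeta_partial_sum_le (s : R) (j : nat) : 1 < s ->
  sum_n (fun i => / npow (S i) s) j <= 1 + (1 - npow (S j) (1 - s)) / (s - 1).
Proof.
  intros Hs. induction j as [|j IH].
  - rewrite sum_O. unfold npow, Rpower. simpl INR.
    rewrite ln_1, !Rmult_0_r, exp_0, Rinv_1. unfold Rdiv. lra.
  - rewrite sum_Sn. change plus with Rplus.
    assert (Hstep := npow_telescope s (S j) Hs ltac:(lia)).
    assert (Hdiv : / npow (S (S j)) s
      <= (npow (S j) (1 - s) - npow (S (S j)) (1 - s)) / (s - 1)).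
    { apply Rle_div_r; lra. }
    replace (1 + (1 - npow (S (S j)) (1 - s)) / (s - 1)) with
      (1 + (1 - npow (S j) (1 - s)) / (s - 1)
       + (npow (S j) (1 - s) - npow (S (S j)) (1 - s)) / (s - 1)) by (field; lra).
    apply Rplus_le_compat; assumption.
Qed.

Lemma ex_series_zeta (s : R) : 1 < s -> ex_series (fun j => / npow (S j) s).
Proof.
  intros Hs.
  destruct (ex_finite_lim_seq_incr
    (sum_n (fun j => / npow (S j) s)) (1 + 1 / (s - 1))) as [l Hl].
  - intros j. rewrite sum_Sn. change plus with Rplus.
    pose proof (Rinv_0_lt_compat _ (npow_pos (S (S j)) s)). lra.
  - intros j. eapply Rle_trans; [apply zeta_partial_sum_le, Hs|].
    apply Rplus_le_compat_l, Rmult_le_compat_r.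
    + left; apply Rinv_0_lt_compat; lra.
    + pose proof (npow_pos (S j) (1 - s)). lra.
  - exists l. exact Hl.
Qed.

(** * Summation of the decomposition *)

Theorem mainTheorem1 :
  forall k : nat, (2 <= k)%nat ->
  forall s : R, 1 < s ->
  forall x y z : nat -> R, parametrized k s x y z ->
    (forall n : nat, (1 <= n)%nat ->
       INR k / npow n s = 1 / x n + 1 / y n + 1 / z n) /\
    ex_series (G_term x y z) /\
    G x y z = INR k * zeta s.
Proof.
  intros k _ s Hs x y z Hpar.
  assert (Hid : forall n : nat, (1 <= n)%nat ->
    INR k / npow n s = 1 / x n + 1 / y n + 1 / z n).
  { intros n Hn.
    destruct (Hpar n Hn) as (Hx & Hy & Hz & t & m & Ht & _ & HF & Ey & Ez).
    apply (egyptian_identity k (x n) (y n) (z n) t m); auto using npow_pos. }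
  assert (Hterm : forall j, INR k * / npow (S j) s = G_term x y z j).
  { intros j. apply Hid; lia. }
  split; [exact Hid | split].
  - eapply ex_series_ext; [exact Hterm|].
    apply (ex_series_scal (V := R_NormedModule) (INR k) (fun j => / npow (S j) s)).
    apply ex_series_zeta, Hs.
  - unfold G, zeta. rewrite <- Series_scal_l.
    symmetry. apply Series_ext, Hterm.
Qed.
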